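(* Let $n\ge1$. The finite representation property holds for the signature $(\langle\ \rangle;,\mathsf A_1,\dots,\mathsf A_n)$ for representation by injective $n$-ary partial functions: every finite $(\langle\ \rangle;,\mathsf A_1,\dots,\mathsf A_n)$-algebra that is representable by injective $n$-ary partial functions is isomorphic to an algebra of $n$-ary partial functions (of the same signature) that has a finite base and all of whose elements are injective.
   Context: Fix $n\ge 1$; $i$ ranges over $\{1,\dots,n\}$. The signature has an $(n+1)$-ary operation (composition), written $\langle a_1,\dots,a_n\rangle ; b$ (also $\boldsymbol a; b$), and unary operations $\mathsf A_1,\dots,\mathsf A_n$. Algebras are nonempty. An $n$-ary partial function on a set $X$ is a set $f\subseteq X^{n+1}$ such that $(\boldsymbol x,y),(\boldsymbol x,z)\in f$ implies $y=z$ (where $\boldsymbol x\in X^n$); it is injective if $(\boldsymbol x,z),(\boldsymbol y,z)\in f$ implies $\boldsymbol x=\boldsymbol y$. An algebra of $n$-ary partial functions of this signature is an algebra whose elements are $n$-ary partial functions, for which there are a set $X$ (the base) and an equivalence relation $E$ on $X$ such that every tuple $(x_1,\dots,x_{n+1})$ in every element lies in $X^{n+1}$ and has pairwise $E$-equivalent entries, and whose operations are $\boldsymbol f; g=\{(\boldsymbol x,z)\in X^{n+1} : \exists \boldsymbol y\in X^n,\ (\boldsymbol x,y_i)\in f_i \text{ for each } i \text{ and } (\boldsymbol y,z)\in g\}$, $\mathsf A_i(f)=\{(\boldsymbol x,x_i)\in X^{n+1} : x_1,\dots,x_n \text{ all } E\text{-equivalent and there is no } y\in X \text{ with } (\boldsymbol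 x,y)\in f\}$. An algebra is representable by injective $n$-ary partial functions if it is isomorphic to an algebra of $n$-ary partial functions of the same signature all of whose elements are injective. *)

(* Defs.v *)
From Stdlib Require Import RelationClasses.
From mathcomp Require Import all_boot.
From mathcomp Require Import boolp classical_sets functions cardinality.

Set Implicit Arguments.
Unset Strict Implicit.
Unset Printing Implicit Defensive.

Local Open Scope classical_set_scope.

(* Abstract algebras of the signature: [comp a b] is <a_1, ..., a_n> ; b and
   [antidom i] is A_i, with indices running over 0, ..., n-1. *)
Record algebra (n : nat) := Algebra {
  carrier :> Type;
  carrier_nonempty : inhabited carrier;
  comp : n.-tuple carrier -> carrier -> carrier;
  antidom : 'I_n -> carrier -> carrier
}.

(* The subsets of X^(n+1), with X^(n+1) presented as X^n * X. *)
Definition graph (n : nat) (X : Type) := set (n.-tuple X * X).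

Definition partial_function n X (f : graph n X) : Prop :=
  forall x y z, f (x, y) -> f (x, z) -> y = z.

Definition injective_graph n X (f : graph n X) : Prop :=
  forall x y z, f (x, z) -> f (y, z) -> x = y.

Definition pairwise_related X (E : X -> X -> Prop) m (t : m.-tuple X) : Prop :=
  forall i j : 'I_m, E (tnth t i) (tnth t j).

Definition graph_comp n X (f : n.-tuple (graph n X)) (g : graph n X) :
    graph n X :=
  [set p | exists y : n.-tuple X,
     (forall i : 'I_n, tnth f i (p.1, tnth y i)) /\ g (y, p.2)].

Definition graph_antidom n X (E : X -> X -> Prop) (i : 'I_n) (f : graph n X) :
    graph n X :=
  [set p | [/\ p.2 = tnth p.1 i, pairwise_related E p.1 &
               ~ exists y : X, f (p.1, y)]].

(* [F] is the universe of an algebra of n-ary partial functions with base [X]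
   and equivalence relation [E]. *)
Record pfun_algebra n X (E : X -> X -> Prop) (F : set (graph n X)) : Prop := {
  pfun_equiv : Equivalence E;
  pfun_nonempty : F !=set0;
  pfun_functional : forall f, F f -> partial_function f;
  pfun_related : forall f x y, F f -> f (x, y) ->
    pairwise_related E [tuple of rcons x y];
  pfun_comp : forall (f : n.-tuple (graph n X)) g,
    (forall i, F (tnth f i)) -> F g -> F (graph_comp f g);
  pfun_antidom : forall i f, F f -> F (graph_antidom E i f)
}.

Definition isomorphic_to n (A : algebra n) X (E : X -> X -> Prop)
    (F : set (graph n X)) : Prop :=
  exists h : A -> graph n X,
    [/\ set_bij [set: A] F h,
        forall (a : n.-tuple A) (b : A),
          h (comp a b) = graph_comp (map_tuple h a) (h b) &
        forall (i : 'I_n) (a : A),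
          h (antidom i a) = graph_antidom E i (h a)].

Definition injectively_representable_over n (A : algebra n) (X : Type) : Prop :=
  exists (E : X -> X -> Prop) (F : set (graph n X)),
    [/\ pfun_algebra E F, forall f, F f -> injective_graph f &
        isomorphic_to A E F].

Definition injectively_representable n (A : algebra n) : Prop :=
  exists X : Type, injectively_representable_over A X.

(* Main.v *)
Require Import Defs.
From mathcomp Require Import all_boot.
From mathcomp Require Import boolp classical_sets functions cardinality.
From Stdlib Require Import RelationClasses.

Local Open Scope classical_set_scope.

(** The finite base is assembled from pieces of the given representation [h]
    of [A] over [X].

    Say that two tuples of [X^n] lie in the same cell when the same elements
    of [A] are defined at both of them; since [A] is finite, there are finitely
    many cells.  The new base consists of the restrictions [S | a] of elements
    [a] of [A] to the cells [S] on which they are defined, again finitely many,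
    two of them being equivalent when they live on the same cell.  An element
    [b] sends [(p_1, ..., p_n)], all on the cell [S], to the composite
    [<p_1, ..., p_n> ; b], provided this is defined on [S].

    The composite [<S | a_1, ..., S | a_n> ; b] is the restriction to [S] of
    the element [<a_1, ..., a_n> ; b] of [A], so its domain is either all of
    [S] or empty ([graph_comp_germ], [point_total]).  This dichotomy makes the
    antidomain operations come out right ([cayley_antidom]): when the composite
    is not defined on all of [S], it is defined nowhere on [S].
    It also transfers injectivity ([cayley_injective]): two argument
    tuples with the same value on [S] have, at each tuple of [S], pointwise
    values on which the injective function [b] agrees.  Composition is
    preserved because composition of partial functions is superassociative
    ([graph_compA]).

    The representation is faithful ([cayley_faithful]) because the [i]-th
    projection is the antidomain [A_i] of the empty function, which is
    the composite [<A_1 b, ..., A_n b> ; b]: a tuple [x] of [X^n] where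
    [h a] and [h b] differ yields the tuple of projections restricted to the
    cell of [x], which the actions of [a] and [b] separate. *)

(** * Generalities *)

Lemma finite_set_powerset (T : Type) :
  finite_set [set: T] -> finite_set [set: set T].
Proof.
move=> /finite_setP[n /card_set_bijP[f [f_fun f_inj _]]].
pose g (B : {set 'I_n}) : set T := [set t | exists2 i, i \in B & f t = i].
apply: (@sub_finite_set _ _ (g @` setT)); last exact/finite_image/finite_finset.
move=> S _; exists [set i : 'I_n | `[< exists2 t, S t & f t = i >] ]%SET => //.
apply/seteqP; split => [t [i]|t St].
  rewrite inE => /asboolP[u Su fu] ft.
  by rewrite (_ : t = u) //; apply: f_inj; rewrite ?inE // fu ft.
have lt_ft : f t < n by exact: f_fun.
by exists (Ordinal lt_ft) => //; rewrite inE; apply/asboolP; exists t.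
Qed.

Lemma pairwise_related_rcons X (E : X -> X -> Prop) n (x : n.-tuple X) y :
  Equivalence E -> (forall i, E (tnth x i) y) ->
  pairwise_related E [tuple of rcons x y].
Proof.
move=> [Erefl Esym Etrans] Exy.
suff Ey k : E (tnth [tuple of rcons x y] k) y.
  by move=> i j; apply: Etrans (Ey i) (Esym _ _ (Ey j)).
rewrite (tnth_nth y) /= nth_rcons size_tuple.
case: ltnP => [lt_kn|_]; last by rewrite if_same.
by have := Exy (Ordinal lt_kn); rewrite (tnth_nth y).
Qed.

Lemma tnth_rcons_left X n (x : n.-tuple X) y (i : 'I_n) :
  tnth [tuple of rcons x y] (widen_ord (leqnSn n) i) = tnth x i.
Proof. by rewrite !(tnth_nth y) /= nth_rcons size_tuple ltn_ord. Qed.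

Lemma tnth_rcons_last X n (x : n.-tuple X) y :
  tnth [tuple of rcons x y] ord_max = y.
Proof. by rewrite (tnth_nth y) /= nth_rcons size_tuple ltnn eqxx. Qed.

Lemma graph_comp_functional n X (f : n.-tuple (graph n X)) (g : graph n X) :
  (forall i, partial_function (tnth f i)) -> partial_function g ->
  partial_function (graph_comp f g).
Proof.
move=> f_fun g_fun x z w [y [/= fy gy]] [u [/= fu gu]].
apply: g_fun gy _; rewrite (_ : y = u) //.
by apply/eq_from_tnth => i; apply: f_fun (fy i) (fu i).
Qed.

(** Superassociativity; functionality of the inner functions [f] matches the
    intermediate tuples that the [n] components of the right-hand side
    choose independently. *)
Lemma graph_compA n X (f g : n.-tuple (graph n X)) (k : graph n X) :
  0 < n -> (forall i, partial_function (tnth f i)) ->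
  graph_comp f (graph_comp g k)
  = graph_comp (map_tuple (graph_comp f) g) k.
Proof.
move=> n_gt0 f_fun; apply/seteqP; split => -[x z] /=.
  move=> [y [/= fy [w [/= gw kw]]]]; exists w; split=> //= i.
  by rewrite tnth_map; exists y; split=> //=; exact: gw.
move=> [w [/= fgw kw]].
have {}fgw i : exists y : n.-tuple X,
    (forall j, tnth f j (x, tnth y j)) /\ tnth g i (y, tnth w i).
  by have := fgw i; rewrite tnth_map.
have [y [fy _]] := fgw (Ordinal n_gt0).
exists y; split=> //=; exists w; split=> //= i.
have [u [fu gu]] := fgw i.
rewrite (_ : y = u) //.
by apply/eq_from_tnth => j; apply: f_fun (fy j) (fu j).
Qed.

(** The closure conditions on the universe of a concrete algebra hold for the
    image of any homomorphism into graphs, so that a representation amounts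
    to an injective homomorphism with the expected values. *)
Lemma injectively_representable_of_embedding n (A : algebra n) (X : Type)
    (E : X -> X -> Prop) (h : A -> graph n X) :
  Equivalence E -> injective h ->
  (forall a, partial_function (h a)) -> (forall a, injective_graph (h a)) ->
  (forall a x y, h a (x, y) -> pairwise_related E [tuple of rcons x y]) ->
  (forall (a : n.-tuple A) b,
     h (Defs.comp a b) = graph_comp (map_tuple h a) (h b)) ->
  (forall i a, h (antidom i a) = graph_antidom E i (h a)) ->
  injectively_representable_over A X.
Proof.
move=> E_equiv h_inj h_fun h_injg h_rel h_comp h_antidom.
exists E, (range h); split; last first.
- exists h; split=> //; split=> [a _||f [a]]; first by exists a.
    by move=> a b _ _; exact: h_inj.
  by exists a.
- by move=> _ [a _ <-].
split=> //.
- by case: (carrier_nonempty A) => a; exists (h a), a.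
- by move=> _ [a _ <-].
- by move=> _ x y [a _ <-]; exact: h_rel.
- move=> f _ Ff [b _ <-].
  have /choice[a ha] : forall i, exists a, h a = tnth f i.
    by move=> i; have [a _ ha] := Ff i; exists a.
  exists (Defs.comp [tuple a i | i < n] b) => //.
  rewrite h_comp; congr graph_comp.
  by apply/eq_from_tnth => i; rewrite tnth_map tnth_mktuple.
- by move=> i _ [a _ <-]; exists (antidom i a).
Qed.

(** * The representation on restrictions to cells *)

Section Cells.

Variables (n : nat) (A : algebra n) (X : Type) (E : X -> X -> Prop).
Variable h : A -> graph n X.
Hypothesis n_gt0 : 0 < n.
Hypothesis E_equiv : Equivalence E.
Hypothesis h_functional : forall a, partial_function (h a).
Hypothesis h_injective : forall a, injective_graph (h a).
Hypothesis h_related : forall a x y,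
  h a (x, y) -> pairwise_related E [tuple of rcons x y].
Hypothesis h_comp : forall (a : n.-tuple A) b,
  h (Defs.comp a b) = graph_comp (map_tuple h a) (h b).
Hypothesis h_antidom : forall i a,
  h (antidom i a) = graph_antidom E i (h a).
Hypothesis h_faithful : injective h.

Let i0 : 'I_n := Ordinal n_gt0.

Lemma h_related_args a x y : h a (x, y) -> pairwise_related E x.
Proof.
move=> /h_related E_xy i j.
by have := E_xy (widen_ord (leqnSn n) i) (widen_ord (leqnSn n) j);
  rewrite !tnth_rcons_left.
Qed.

Lemma h_related_value a x y i : h a (x, y) -> E (tnth x i) y.
Proof.
move=> /h_related E_xy.
by have := E_xy (widen_ord (leqnSn n) i) ord_max;
  rewrite tnth_rcons_left tnth_rcons_last.
Qed.

(** The elements of [A] defined at [x]; this set names the cell of [x]. *)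
Definition defined_at (x : n.-tuple X) : set A :=
  [set a | exists z, h a (x, z)].

(** The restriction of [a] to the cell named [S]. *)
Definition germ (S : set A) (a : A) : graph n X :=
  [set p | defined_at p.1 = S /\ h a p].

(** The name of the cell is kept next to the germ, so that being on the same
    cell is an equality of first components. *)
Definition is_point (Sp : set A * graph n X) : Prop :=
  exists a, [/\ Sp.1 a, Sp.2 = germ Sp.1 a & exists x, defined_at x = Sp.1].

Definition point := {Sp | is_point Sp}.

Definition cell (q : point) : set A := (sval q).1.
Definition fun_of_point (q : point) : graph n X := (sval q).2.

Definition same_cell (p q : point) : Prop := cell p = cell q.

(** As in Cayley's theorem, [b] acts by composition on the right; the equation
    forces the composite to be total on the cell of [q], because [q] is. *)
Definition cayley (b : A) : graph n point :=
  [set tq | (forall i, cell (tnth tq.1 i) = cell tq.2) /\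
            fun_of_point tq.2 = graph_comp (map_tuple fun_of_point tq.1) (h b)].

Lemma same_cell_equiv : Equivalence same_cell.
Proof.
split; first by [].
  by move=> p q.
by move=> p q r; rewrite /same_cell => ->.
Qed.

Lemma finite_points : finite_set [set: A] -> finite_set [set: point].
Proof.
move=> A_fin.
rewrite -(preimage_setT (sval : point -> _)).
pose D := [set (Sa.1, germ Sa.1 Sa.2) | Sa in [set: set A] `*` [set: A]].
suff -> : sval @^-1` setT = (sval : point -> _) @^-1` D.
  apply: finite_preimage.
    by move=> p q _ _; apply: eq_sig_hprop => Sp; exact: Prop_irrelevance.
  by apply/finite_image/finite_setX => //; exact: finite_set_powerset.
apply/seteqP; split=> // -[[S p] [a [/= Sa -> x]]] _ /=.
by exists (S, a).
Qed.

Lemma eq_point (p q : point) :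
  cell p = cell q -> fun_of_point p = fun_of_point q -> p = q.
Proof.
case: p q => [[S p] Pp] [[T q] Pq]; rewrite /cell /fun_of_point /= => eST epq.
by apply: eq_exist; rewrite eST epq.
Qed.

Lemma point_germ (q : point) :
  exists a, cell q a /\ fun_of_point q = germ (cell q) a.
Proof. by case: q => Sp [a [Sa e x]]; exists a. Qed.

Lemma cell_inhabited (q : point) : exists x, defined_at x = cell q.
Proof. by case: q => Sp [a [Sa e x]]. Qed.

(** Points are total on their cells: a cell decides as a whole whether an
    element of [A] is defined on it. *)
Lemma point_total (q : point) x :
  defined_at x = cell q -> exists z, fun_of_point q (x, z).
Proof.
have [a [Sa ->]] := point_germ q => xS.
by have [z hz] : defined_at x a by [rewrite xS]; exists z.
Qed.

Lemma point_cell {q : point} {x z} :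
  fun_of_point q (x, z) -> defined_at x = cell q.
Proof. by have [a [Sa ->]] := point_germ q => -[]. Qed.

Lemma point_functional (q : point) : partial_function (fun_of_point q).
Proof.
have [a [_ ->]] := point_germ q.
by move=> x y z [/= _ hy] [/= _ hz]; exact: h_functional hy hz.
Qed.

Lemma tuple_functional (t : n.-tuple point) i :
  partial_function (tnth (map_tuple fun_of_point t) i).
Proof. by rewrite tnth_map; exact: point_functional. Qed.

Lemma point_germs (t : n.-tuple point) (S : set A) :
  (forall i, cell (tnth t i) = S) ->
  exists a : n.-tuple A, map_tuple fun_of_point t = map_tuple (germ S) a.
Proof.
move=> tS.
have /choice[a ta] : forall i, exists a, fun_of_point (tnth t i) = germ S a.
  by move=> i; have [a [_ ta]] := point_germ (tnth t i); exists a; rewrite -(tS i).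
exists [tuple a i | i < n].
by apply/eq_from_tnth => i; rewrite !tnth_map tnth_ord_tuple ta.
Qed.

(** Only the outer arguments need restricting: [b] is applied to values of the
    [a_i], which may lie in any cell. *)
Lemma graph_comp_germ (S : set A) (a : n.-tuple A) b :
  graph_comp (map_tuple (germ S) a) (h b) = germ S (Defs.comp a b).
Proof.
rewrite /germ h_comp; apply/seteqP; split=> -[x z].
  move=> [y [/= ay bz]]; split; first by have := ay i0; rewrite tnth_map => -[].
  by exists y; split=> //= i; have := ay i; rewrite !tnth_map => -[].
move=> [/= xS [y [/= ay bz]]]; exists y; split=> //= i.
by have := ay i; rewrite !tnth_map.
Qed.

(** Being the restriction of an element of [A] by [graph_comp_germ], a composite
    that is defined at one tuple is defined on the whole cell. *)
Lemma comp_point (t : n.-tuple point) (S : set A) b x z :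
  (forall i, cell (tnth t i) = S) ->
  graph_comp (map_tuple fun_of_point t) (h b) (x, z) ->
  exists q : point, cell q = S /\
    fun_of_point q = graph_comp (map_tuple fun_of_point t) (h b).
Proof.
move=> /point_germs[a ->]; rewrite graph_comp_germ => -[/= xS habz].
have q_point : is_point (S, germ S (Defs.comp a b)).
  by exists (Defs.comp a b); split; [rewrite /= -xS; exists z| |exists x].
by exists (exist _ _ q_point).
Qed.

Lemma cayley_functional b : partial_function (cayley b).
Proof.
move=> t p q [/= tp ep] [/= tq eq]; apply: eq_point; last by rewrite ep eq.
by rewrite -(tp i0) tq.
Qed.

Lemma cayley_injective b : injective_graph (cayley b).
Proof.
move=> t u q; rewrite /cayley /= => -[tq et] [uq eu].
have tu_sub (t' u' : n.-tuple point) i x y :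
    (forall i, cell (tnth t' i) = cell q) ->
    fun_of_point q = graph_comp (map_tuple fun_of_point t') (h b) ->
    fun_of_point q = graph_comp (map_tuple fun_of_point u') (h b) ->
    fun_of_point (tnth t' i) (x, y) -> fun_of_point (tnth u' i) (x, y).
  move=> t'q et' eu' t'xy.
  have [|z qz] := point_total q x; first by rewrite (point_cell t'xy).
  have [v [/= t'v bv]] : graph_comp (map_tuple fun_of_point t') (h b) (x, z).
    by rewrite -et'.
  have [w [/= u'w bw]] : graph_comp (map_tuple fun_of_point u') (h b) (x, z).
    by rewrite -eu'.
  have := t'v i; rewrite tnth_map => /(point_functional _ _ _ _ t'xy) ->.
  by rewrite (h_injective _ _ _ _ bv bw); have := u'w i; rewrite tnth_map.
apply/eq_from_tnth => i; apply: eq_point; first by rewrite tq uq.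
by apply/seteqP; split=> -[x y]; apply: tu_sub.
Qed.

Lemma cayley_related b t q :
  cayley b (t, q) -> pairwise_related same_cell [tuple of rcons t q].
Proof.
by move=> [tq _]; apply: pairwise_related_rcons => //; exact: same_cell_equiv.
Qed.

Lemma cayley_comp (a : n.-tuple A) b :
  cayley (Defs.comp a b) = graph_comp (map_tuple cayley a) (cayley b).
Proof.
apply/seteqP; split=> -[t q]; rewrite /cayley /=.
  rewrite h_comp graph_compA //; last exact: tuple_functional.
  move=> [tq eq].
  have [x /point_total[z]] := cell_inhabited q.
  rewrite {1}eq => -[w [/= tw _]].
  (* The intermediate composites are points, being defined at [x]. *)
  have /choice[u tu] : forall i, exists p : point, cell p = cell q /\
      fun_of_point p
      = graph_comp (map_tuple fun_of_point t) (h (tnth a i)).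
    move=> i; apply: (comp_point t (cell q) _ x (tnth w i) tq).
    by have := tw i; rewrite !tnth_map.
  exists [tuple u i | i < n]; split=> [i|] /=.
    rewrite tnth_map tnth_mktuple; have [uq eu] := tu i.
    by split=> //= j; rewrite tq uq.
  split=> [i|]; first by rewrite tnth_mktuple; have [] := tu i.
  rewrite eq; congr graph_comp.
  apply/eq_from_tnth => i.
  by rewrite !tnth_map tnth_ord_tuple; have [_ ->] := tu i.
move=> [u [/= tu [uq eq]]].
have {}tu i : cayley (tnth a i) (t, tnth u i) by have := tu i; rewrite tnth_map.
split=> [i|]; first by have [/= -> _] := tu i0; rewrite uq.
rewrite h_comp graph_compA //; last exact: tuple_functional.
rewrite eq; congr graph_comp.
by apply/eq_from_tnth => i; rewrite !tnth_map; have [_ ->] := tu i.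
Qed.

Lemma cayley_antidom i b :
  cayley (antidom i b) = graph_antidom same_cell i (cayley b).
Proof.
apply/seteqP; split=> -[t q] /=.
  move=> [/= tq]; rewrite h_antidom => eq.
  have q_tail x z : fun_of_point q (x, z) -> fun_of_point (tnth t i) (x, z).
    by rewrite eq => -[y [/= ty [/= -> _ _]]]; have := ty i; rewrite tnth_map.
  split=> /=.
  - apply: eq_point; first by rewrite tq.
    apply/seteqP; split=> -[x z]; first exact: q_tail.
    move=> tz; have [|w qw] := point_total q x.
      by rewrite (point_cell tz) tq.
    by rewrite (point_functional _ _ _ _ tz (q_tail _ _ qw)).
  - by move=> j k; rewrite /same_cell !tq.
  - move=> [u [/= tu eu]].
    have [x xS] := cell_inhabited q.
    have [z] := point_total q x xS; rewrite eq => -[y [/= ty [/= _ _ nby]]].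
    have [|w] := point_total u x; first by rewrite xS -(tq i0) tu.
    rewrite eu => -[v [/= tv bv]]; apply: nby; exists w.
    rewrite (_ : y = v) //; apply/eq_from_tnth => j.
    exact: tuple_functional (ty j) (tv j).
move=> [/= -> same_t nbt].
have ti j : cell (tnth t j) = cell (tnth t i) by exact: same_t.
split=> //=; rewrite h_antidom; apply/seteqP; split=> -[x z].
  (* The other coordinates of [t] are defined at [x] too, and their values
     there are related to the entries of [x], hence to one another. *)
  move=> tz.
  have /choice[v tv] : forall j, exists v, fun_of_point (tnth t j) (x, v).
    by move=> j; apply: point_total; rewrite ti (point_cell tz).
  exists [tuple v j | j < n]; split=> /= [j|].
    by rewrite tnth_map tnth_mktuple.
  split=> /=.
  - by rewrite tnth_mktuple; exact: point_functional tz (tv i).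
  - have [_ Esym Etrans] := E_equiv.
    have Ev j : E (tnth x i0) (v j).
      have := tv j; have [a [_ ->]] := point_germ (tnth t j).
      by move=> -[_ /h_related_value].
    move=> j k; rewrite !tnth_mktuple.
    exact: Etrans (Esym _ _ (Ev j)) (Ev k).
  - move=> [w bw].
    have [|p [pS ep]] := comp_point t _ b x w ti.
      by exists [tuple v j | j < n]; split=> //= j; rewrite tnth_map tnth_mktuple.
    by apply: nbt; exists p; split=> //= j; rewrite ti pS.
by move=> [y [/= ty [/= -> _ _]]]; have := ty i; rewrite tnth_map.
Qed.

Lemma projection_exists i :
  exists a, forall x z,
    h a (x, z) <-> z = tnth x i /\ pairwise_related E x.
Proof.
have [b] := carrier_nonempty A.
(* The composite <A_1 b, ..., A_n b> ; b evaluates [b] outside its domain,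
   so it is empty. *)
pose empty := Defs.comp [tuple antidom j b | j < n] b.
have emptyE x z : ~ h empty (x, z).
  rewrite h_comp => -[y [/= ay byz]].
  have {}ay j : graph_antidom E j (h b) (x, tnth y j).
    by have := ay j; rewrite tnth_map tnth_mktuple h_antidom.
  have [_ _ nbx] := ay i0; apply: nbx; exists z => /=.
  rewrite (_ : x = y) //; apply/eq_from_tnth => j.
  by have [/= -> _ _] := ay j.
exists (antidom i empty) => x z; rewrite h_antidom; split; first by case.
by move=> [-> Ex]; split=> // -[y /emptyE].
Qed.

(** At a tuple [x] where [h a] is defined, the germs of the projections form a
    tuple of points that the action of [a] sends to the germ of [a] itself. *)
Lemma cayley_faithful : injective cayley.
Proof.
suff sub a b : cayley a = cayley b -> h a `<=` h b.
  by move=> a b eab; apply/h_faithful/seteqP; split; exact: sub.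
move=> eab [x z] axz.
have Ex : pairwise_related E x := h_related_args _ _ _ axz.
have /choice[pi piE] := projection_exists.
pose S := defined_at x.
have pi_point i : is_point (S, germ S (pi i)).
  by exists (pi i); split=> //=; [exists (tnth x i); apply/piE|exists x].
have a_point : is_point (S, germ S a).
  by exists a; split=> //=; [exists z|exists x].
pose t : n.-tuple point := [tuple exist _ _ (pi_point i) | i < n].
have a_tq : cayley a (t, exist _ _ a_point).
  split=> /= [i|]; first by rewrite tnth_mktuple.
  have -> : map_tuple fun_of_point t = map_tuple (germ S) [tuple pi i | i < n].
    by apply/eq_from_tnth => i; rewrite !tnth_map !tnth_ord_tuple.
  rewrite graph_comp_germ /fun_of_point /= /germ h_comp.
  apply/seteqP; split=> -[y w] [/= yS].
    move=> ayw; split=> //; exists y; split=> //= i.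
    rewrite tnth_map tnth_mktuple; apply/piE; split=> //.
    exact: h_related_args ayw.
  move=> [v [/= piv avw]]; split=> //; rewrite (_ : y = v) //.
  apply/eq_from_tnth => i; have := piv i.
  by rewrite tnth_map tnth_mktuple => /piE[].
move: a_tq; rewrite eab => -[_ /= eb].
have : germ S a (x, z) by [].
rewrite [germ S a]eb => -[y [/= ty byz]]; rewrite (_ : x = y) //.
apply/eq_from_tnth => i; have := ty i.
by rewrite tnth_map tnth_mktuple => -[_ /piE[]].
Qed.

Lemma points_representation : injectively_representable_over A point.
Proof.
apply: (@injectively_representable_of_embedding _ _ _ same_cell cayley).
- exact: same_cell_equiv.
- exact: cayley_faithful.
- exact: cayley_functional.
- exact: cayley_injective.
- exact: cayley_related.
- exact: cayley_comp.
- exact: cayley_antidom.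
Qed.

End Cells.

Theorem corollary5p4 (n : nat) (n_ge1 : (1 <= n)%N) (A : algebra n)
  (A_finite : finite_set [set: carrier A])
  (A_rep : injectively_representable A) :
  exists X : Type,
    finite_set [set: X] /\ injectively_representable_over A X.
Proof.
have [X [E [F [[E_equiv _ F_fun F_rel _ _] F_inj]]]] := A_rep.
move=> [h [[h_F h_faithful _] h_comp h_antidom]].
have Fh a : F (h a) by exact: h_F.
exists (point n A X h); split; first exact: finite_points.
apply: (points_representation n A X E) => //.
- by move=> a; exact: F_fun.
- by move=> a; exact: F_inj.
- by move=> a x y; exact: F_rel.
- by move=> a b; apply: h_faithful; rewrite inE.
Qed.
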